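(* Let $\mathbb H$ be the Heisenberg group and let $N:\mathbb H\to[0,+\infty)$ be a homogeneous norm. Then the unit ball $B:=\{p\in\mathbb H:N(p)\le1\}$ is a star-like Lipschitz domain.
   Context: The Heisenberg group $\mathbb H$ is the three-dimensional real vector space $\mathrm{span}\{X,Y,Z\}$ with the Lie bracket whose only nontrivial relation is $[X,Y]=Z$, equipped with the group operation $p\cdot q=p+q+\frac12[p,q]$; the neutral element is $0$ and $p^{-1}=-p$. Dilations: $\delta_\lambda(xX+yY+zZ)=\lambda xX+\lambda yY+\lambda^2zZ$ for $\lambda>0$. A homogeneous norm is a function $N:\mathbb H\to[0,+\infty)$ such that for all $p,q\in\mathbb H$ and $\lambda>0$: $N(p)=0\iff p=0$; $N(pq)\le N(p)+N(q)$; $N(p^{-1})=N(p)$; $N(\delta_\lambda p)=\lambda N(p)$. Star-like means that, in the vector space $\mathrm{span}\{X,Y,Z\}$, for each $p\in B$ the straight segment from $0$ to $p$ is contained in $B$. $B$ is a Lipschitz domain if near each of its boundary points it coincides, in suitable smooth coordinates, with the region on one side of the graph of a Lipschitz function. *)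

(* Defs.v *)
From HB Require Import structures.
From mathcomp Require Export all_boot all_order all_algebra.
From mathcomp Require Export all_classical all_reals all_analysis.

Set Implicit Arguments.
Unset Strict Implicit.
Unset Printing Implicit Defensive.

Export Order.TTheory GRing.Theory Num.Theory.
Export numFieldNormedType.Exports.

Local Open Scope classical_set_scope.
Local Open Scope ring_scope.

Section Heisenberg.
Variable R : realType.

(* The Heisenberg group is 'rV[R]_3, identified with span{X, Y, Z} through the
   basis X, Y, Z. *)
Definition heisX : 'rV[R]_3 := delta_mx 0 0.
Definition heisY : 'rV[R]_3 := delta_mx 0 1.
Definition heisZ : 'rV[R]_3 := delta_mx 0 2%:R.

(* Bilinear alternating extension of [X, Y] = Z, [X, Z] = [Y, Z] = 0. *)
Definition heis_bracket (p q : 'rV[R]_3) : 'rV[R]_3 :=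
  (p 0 0 * q 0 1 - p 0 1 * q 0 0) *: heisZ.

Definition heis_mul (p q : 'rV[R]_3) : 'rV[R]_3 :=
  p + q + 2^-1 *: heis_bracket p q.

Definition heis_inv (p : 'rV[R]_3) : 'rV[R]_3 := - p.

Definition heis_dil (l : R) (p : 'rV[R]_3) : 'rV[R]_3 :=
  (l * p 0 0) *: heisX + (l * p 0 1) *: heisY + (l ^+ 2 * p 0 2%:R) *: heisZ.

Record homogeneous_norm (N : 'rV[R]_3 -> R) : Prop := HomogeneousNorm {
  hnorm_ge0 : forall p, 0 <= N p;
  hnorm_eq0 : forall p, N p = 0 <-> p = 0;
  hnorm_mul : forall p q, N (heis_mul p q) <= N p + N q;
  hnorm_inv : forall p, N (heis_inv p) = N p;
  hnorm_dil : forall l p, 0 < l -> N (heis_dil l p) = l * N p }.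

Definition unit_ball (N : 'rV[R]_3 -> R) : set 'rV[R]_3 :=
  [set p | N p <= 1].

End Heisenberg.

Definition star_like (R : realType) (V : lmodType R) (A : set V) : Prop :=
  forall p, A p -> forall t : R, 0 <= t <= 1 -> A (t *: p).

Section LipschitzDomain.
Variable R : realType.

(* f is of class C^k on the (open) set U; in finite dimension, continuity of
   all iterated directional derivatives is continuity of the differentials. *)
Fixpoint class_C (m n k : nat) (U : set 'rV[R]_m)
    (f : 'rV[R]_m -> 'rV[R]_n) : Prop :=
  match k with
  | 0 => forall x, U x -> {for x, continuous f}
  | k'.+1 => (forall x, U x -> differentiable f x) /\
             (forall v, class_C k' U ('D_v f))
  end.

Definition smooth_on (m n : nat) (U : set 'rV[R]_m)
    (f : 'rV[R]_m -> 'rV[R]_n) : Prop :=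
  forall k, class_C k U f.

(* phi restricts to a C^oo diffeomorphism from the open set U onto the open
   set phi(U). *)
Definition smooth_coordinates (n : nat) (U : set 'rV[R]_n)
    (phi : 'rV[R]_n -> 'rV[R]_n) : Prop :=
  [/\ open U, open (phi @` U), smooth_on U phi &
      exists psi : 'rV[R]_n -> 'rV[R]_n,
        smooth_on (phi @` U) psi /\ forall x, U x -> psi (phi x) = x].

Definition boundary (T : topologicalType) (A : set T) : set T :=
  closure A `\` interior A.

(* The points on or below the graph of g, the last coordinate being the
   vertical one. *)
Definition subgraph (n : nat) (g : 'rV[R]_n -> R) : set 'rV[R]_n.+1 :=
  [set y : 'rV[R]_n.+1 | y 0 ord_max <= g (col' ord_max y)].

(* The graph itself belongs to the region: this is the convention for closed
   domains. The side is immaterial, as (y', t) |-> (y', - t) is a smooth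
   change of coordinates; g may be taken globally defined, as real-valued
   Lipschitz functions extend. *)
Definition lipschitz_domain (n : nat) (B : set 'rV[R]_n.+1) : Prop :=
  forall p, boundary B p ->
  exists (U : set 'rV[R]_n.+1) (phi : 'rV[R]_n.+1 -> 'rV[R]_n.+1)
         (g : 'rV[R]_n -> R),
    [/\ U p, smooth_coordinates U phi, [lipschitz g x | x in setT] &
        forall q, U q -> (B q <-> subgraph g (phi q))].

End LipschitzDomain.

(* Main.v *)
From mathcomp Require Import ring lra.
Require Import Defs.

(* With (1 + t)/2 and (1 - t)/2 as dilation factors, t p is exactly the product
   of a dilate of p and a dilate of p^-1, which gives star-likeness.
   For the Lipschitz property it suffices to find, near each p <> 0, one cone of
   directions in which one can move from any point of the closed set B without
   leaving it: B is then a subgraph in linear coordinates sending the axis of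
   the cone to the last basis vector. Dilating q by 1 - s frees a room of s in
   the norm, to be spent on multiplications by horizontal vectors of length
   O(s). Off the z-axis these reach a full neighbourhood of size O(s), so the
   cone is around the generator -(x, y, 2z) of the dilations. On the z-axis they
   do not move z to first order, but shrinking z at fixed x, y does not increase
   the norm, so the cone is around -(0, 0, 3z), steeper than the dilations. *)

Set Implicit Arguments.
Unset Strict Implicit.
Unset Printing Implicit Defensive.

Local Open Scope classical_set_scope.
Local Open Scope ring_scope.

(** * Linear maps of row vectors as smooth coordinates *)

Section RowVectors.
Variable R : realType.

Lemma rV_norm_le n (x : 'rV[R]_n) (c : R) : 0 <= c ->
  (`|x| <= c) <-> (forall j, `|x 0 j| <= c).
Proof.
move=> c0; rewrite [`|x|]/Num.norm /= mx_normrE; split.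
  move=> /bigmax_leP[_ h] j; exact: (h (0, j)).
by move=> h; apply/bigmax_leP; split => // -[i j] _ /=; rewrite ord1.
Qed.

Lemma rV_coord_le n (x : 'rV[R]_n) j : `|x 0 j| <= `|x|.
Proof. exact: (rV_norm_le x (normr_ge0 x)).1. Qed.

Lemma mulmxr_continuous m n (A : 'M[R]_(m, n)) :
  continuous (mulmxr A : 'rV_m -> 'rV_n).
Proof.
apply: bounded_linear_continuous; apply/linear_boundedP.
pose c := \sum_i \sum_j `|A i j|.
have c0 : 0 <= c by apply: sumr_ge0 => i _; apply: sumr_ge0.
near=> r => x.
have cr : c <= r by near: r; apply: nbhs_pinfty_ge; rewrite num_real.
apply: le_trans (ler_wpM2r _ cr); last exact: normr_ge0.
apply/rV_norm_le => [|j]; first by rewrite mulr_ge0.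
rewrite /= mxE mulr_suml; apply: le_trans (ler_norm_sum _ _ _) _.
apply: ler_sum => i _; rewrite normrM mulrC.
apply: ler_pM => //; last exact: rV_coord_le.
by rewrite (bigD1 j) //= lerDl sumr_ge0.
Unshelve. all: by end_near. Qed.

Lemma class_C_cst m n (U : set 'rV[R]_m) (a : 'rV[R]_n) k :
  class_C k U (cst a).
Proof.
elim: k a => [|k IH] a /=; first by move=> x _; exact: cst_continuous.
split=> [x _|v]; first exact: differentiable_cst.
rewrite (_ : 'D_v (cst a) = cst 0); first exact: IH.
by apply/funext => x; exact: derive_cst.
Qed.

Lemma smooth_on_mulmxr m n (U : set 'rV[R]_m) (A : 'M[R]_(m, n)) :
  smooth_on U (mulmxr A : 'rV_m -> 'rV_n).
Proof.
have Ac := @mulmxr_continuous m n A.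
case=> [|k] /=; first by move=> x _; exact: Ac.
split=> [x _|v]; first exact: linear_differentiable.
rewrite (_ : 'D_v _ = cst (v *m A)); first exact: class_C_cst.
apply/funext => x; rewrite deriveE; last exact: linear_differentiable.
by rewrite diff_lin.
Qed.

Lemma smooth_coordinates_mulmxr n (U : set 'rV[R]_n) (A : 'M[R]_n) :
  A \in unitmx -> open U -> smooth_coordinates U (mulmxr A).
Proof.
move=> Au Uo; split=> //.
- rewrite (_ : _ @` U = mulmxr (invmx A) @^-1` U).
    by move/continuousP: (@mulmxr_continuous _ _ (invmx A)); apply.
  apply/seteqP; split=> [_ [x Ux <-]|y Uy] /=; first by rewrite mulmxK.
  by exists (y *m invmx A) => //=; rewrite mulmxKV.
- exact: smooth_on_mulmxr.
- exists (mulmxr (invmx A)); split; first exact: smooth_on_mulmxr.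
  by move=> x _ /=; rewrite mulmxK.
Qed.

(** The nonzero row [d] has the right inverse [pinvmx d], so [f] sends [d] to the last basis vector;
    [complete_unitmx] then gives an invertible matrix with the same value at [d]. *)
Lemma unitmx_to_last_axis n (d : 'rV[R]_n.+1) : d != 0 ->
  exists2 A : 'M[R]_n.+1, A \in unitmx & d *m A = delta_mx 0 ord_max.
Proof.
move=> d0; have dfree : row_free d by rewrite -row_leq_rank rank_rV d0.
pose f := pinvmx d *m delta_mx 0 ord_max : 'M[R]_n.+1.
have df : d *m f = delta_mx 0 ord_max by rewrite mulmxA mulmxVp // mul1mx.
have [|g gu gE] := @complete_unitmx _ _ _ d f.
  by rewrite df mxrank_delta rank_rV d0.
by exists g; rewrite // -gE.
Qed.

(** * From inner cones to Lipschitz graphs *)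

(* The cone consists of the directions -v with v near d. *)
Definition uniform_inner_cone n (B : set 'rV[R]_n) (p d : 'rV[R]_n) (e : R) :=
  forall q s v, B q -> `|q - p| <= e -> 0 <= s <= e -> `|v - d| <= e ->
    B (q - s *: v).

Lemma col'_max_eq n (x y : 'rV[R]_n.+1) :
  col' ord_max x = col' ord_max y -> x 0 ord_max = y 0 ord_max -> x = y.
Proof.
move=> /rowP xy xym; apply/rowP => j.
case: (unliftP ord_max j) => [k ->|->//].
by have := xy k; rewrite !mxE.
Qed.

(** In linear coordinates making [d] vertical, every point of [B] near [p] has below it, locally, a
    cone of one fixed slope inside [B]. The supremum of such cones is Lipschitz with that slope, and
    closedness of [B] adds its graph. *)
Lemma lipschitz_domain_cone n (B : set 'rV[R]_n.+1) : closed B ->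
  (forall p, boundary B p ->
    exists (d : 'rV[R]_n.+1) (e : R),
      [/\ d != 0, 0 < e & uniform_inner_cone B p d e]) ->
  lipschitz_domain B.
Proof.
move=> Bcl Bcone p pB; have [d [e0 [dn0 e00 cone0]]] := Bcone p pB.
have Bp : B p by rewrite (closure_id B).1 //; case: pB.
have nd0 : 0 < `|d| by rewrite normr_gt0.
pose e : R := Num.min e0 (`|d| / 2).
have e_gt0 : 0 < e by rewrite lt_min e00 divr_gt0.
have ee0 : e <= e0 by rewrite ge_min lexx.
have ed : e <= `|d| / 2 by rewrite ge_min lexx orbT.
have cone (q : 'rV[R]_n.+1) (s : R) (v : 'rV[R]_n.+1) :
    B q -> `|q - p| <= e -> 0 <= s <= e -> `|v - d| <= e -> B (q - s *: v).
  move=> Bq qp /andP[s0 se] vd.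
  by apply: cone0 => //; rewrite ?s0; lra.
have [A Au dA] := unitmx_to_last_axis dn0.
have dE : delta_mx 0 ord_max *m invmx A = d by rewrite -dA mulmxK.
have [M M0 AM] := linear_lipschitz (@mulmxr_continuous _ _ (invmx A)).
have [M' M'0 AM'] := linear_lipschitz (@mulmxr_continuous _ _ A).
(* In [cone_graph] below, [v - d] has norm at most [M * |w| / t]; the slope [L] is chosen to keep
   this at most [e]. *)
pose L : R := M / e.
have L0 : 0 < L by rewrite divr_gt0.
(* Two points of [U] are less than [e * |d| / 2] apart and [|v| >= |d| / 2], so the descent
   parameter [t] in [cone_graph] does not exceed [e]. *)
pose r : R := Num.min e (e * `|d| / 4).
have r0 : 0 < r by rewrite lt_min e_gt0 divr_gt0 // mulr_gt0.
pose U := ball p r.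
have UE q : U q <-> `|q - p| < r by rewrite /U -ball_normE /= distrC.
have re : r <= e by rewrite ge_min lexx.
have rd : r <= e * `|d| / 4 by rewrite ge_min lexx orbT.
have Uo : open U by exact: ball_open.
pose h (q : 'rV[R]_n.+1) : R := (q *m A) 0 ord_max.
pose c (q : 'rV[R]_n.+1) : 'rV[R]_n := col' ord_max (q *m A).
have cone_graph (q q' : 'rV[R]_n.+1) :
    U q -> U q' -> B q -> h q' <= h q - L * `|c q' - c q| -> B q'.
  move=> /UE Uq /UE Uq' Bq hq.
  pose t := h q - h q'.
  have tL : L * `|c q' - c q| <= t by rewrite /t; lra.
  (* A nonpositive [t] forces [t] and the horizontal displacement to vanish, so that [q' = q]. *)
  have [t0|t0] := leP t 0.
    have c0 : `|c q' - c q| = 0.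
      apply/eqP; rewrite eq_le normr_ge0 andbT -(pmulr_rle0 _ L0); lra.
    have qq' : q *m A = q' *m A.
      apply: col'_max_eq.
        by apply/esym/eqP; rewrite -subr_eq0 -normr_eq0 c0.
      by move: tL t0; rewrite c0 mulr0 /t /h; lra.
    by rewrite -(mulmxK Au q') -qq' mulmxK.
  pose w := (q - q') *m A - t *: delta_mx 0 ord_max.
  have wc : `|w| <= `|c q' - c q|.
    apply/rV_norm_le => // j; case: (unliftP ord_max j) => [k ->|->].
      apply: le_trans (rV_coord_le _ k).
      rewrite /w mulmxBl !mxE eqxx /= eq_sym (negbTE (neq_lift _ _)).
      rewrite mulr0 subr0.
      by rewrite distrC.
    by rewrite /w mulmxBl !mxE !eqxx mulr1 /t /h !mxE subrr normr0.
  pose v := d + t^-1 *: (w *m invmx A).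
  have qE : q' = q - t *: v.
    rewrite /v scalerDr scalerA divff ?gt_eqF // scale1r /w mulmxBl mulmxK //.
    by rewrite -scalemxAl dE [_ *: d + _]addrC subrK subKr.
  have vd : `|v - d| <= e.
    rewrite /v addrC addKr normrZ gtr0_norm ?invr_gt0 // ler_pdivrMl //.
    apply: le_trans (AM w) _; rewrite -ler_pdivlMl //.
    apply: le_trans wc _; rewrite -(ler_pM2l L0); apply: le_trans tL _.
    by rewrite /L le_eqVlt; apply/orP; left; apply/eqP; field; rewrite !gt_eqF.
  have v_ge : `|d| / 2 <= `|v|.
    by have := lerB_dist d (d - v); rewrite subKr (distrC d v); lra.
  have te : t <= e.
    rewrite -(ler_pM2r nd0).
    have : t * `|v| = `|q - q'|.
      by rewrite qE opprB addrC subrK normrZ gtr0_norm.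
    have : `|q - q'| <= `|q - p| + `|q' - p| by rewrite (distrC q') ler_distD.
    have : t * (`|d| / 2) <= t * `|v| by rewrite ler_pM2l.
    lra.
  rewrite qE; apply: cone => //; first by apply: le_trans (ltW Uq) re.
  by rewrite (ltW t0).
(* g is the upper envelope of the downward cones with apexes in B `&` U. *)
pose S x := [set h q - L * `|x - c q| | q in B `&` U].
have Up : U p by exact: ballxx.
have S0 x : S x !=set0 by exists (h p - L * `|x - c p|); exists p.
have Sub x : has_ubound (S x).
  exists (M' * (`|p| + r)) => _ [q [Bq /UE Uq] <-].
  have : h q <= M' * `|q|.
    apply: le_trans (AM' q); apply: le_trans (rV_coord_le _ _).
    exact: ler_norm.
  have : `|q| <= `|p| + r.
    by have := ler_normD (q - p) p; rewrite subrK; lra.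
  move=> qr; have : M' * `|q| <= M' * (`|p| + r) by rewrite ler_pM2l.
  have : 0 <= L * `|x - c q| by rewrite mulr_ge0 // ltW.
  lra.
pose g x := sup (S x).
have glip x y : g x <= g y + L * `|x - y|.
  apply: ge_sup => // _ [q qBU <-].
  have : h q - L * `|y - c q| <= g y by apply: ub_le_sup => //; exists q.
  have : L * `|y - c q| <= L * (`|x - c q| + `|x - y|).
    rewrite ler_pM2l //; have := ler_distD x y (c q).
    by rewrite (distrC y x); lra.
  lra.
exists U, (mulmxr A), g; split=> //.
- exact: smooth_coordinates_mulmxr.
- apply: (@klipschitzW _ _ _ L).
    exact: (@globally_properfilter _ _ (0, 0)).
  move=> [x y] _ /=; have := glip x y; have := glip y x.
  by rewrite (distrC y x) ler_norml; lra.
move=> q Uq; rewrite /subgraph /=; split=> [Bq|hq].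
  by apply: ub_le_sup => //; exists q => //; rewrite subrr normr0 mulr0 subr0.
(* The supremum defining [g] need not be attained: points slightly below [q] are shown to lie in
   [B], and [q] is their limit. *)
rewrite (closure_id B).1 //.
move=> V /nbhs_ballP[z /= z0 zV].
have [a a0 aU] : exists2 a, 0 < a & ball q a `<=` U.
  by apply/nbhs_ballP; apply: open_nbhs_nbhs.
pose m := Num.min z a; have m0 : 0 < m by rewrite lt_min z0.
pose t := m / 2 / `|d|; have t0 : 0 < t by rewrite !divr_gt0.
have td : `|t *: d| < m.
  by rewrite normrZ gtr0_norm // divfK ?gt_eqF //; lra.
have tdb b : m <= b -> ball q b (q - t *: d).
  by move=> mb; rewrite -ball_normE /= opprB addrC subrK; lra.
exists (q - t *: d); split; last by apply/zV/tdb; rewrite ge_min lexx.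
(* q - t d lies strictly below g, hence in one of the cones defining g. *)
have [_ [q1 [Bq1 Uq1] <-] q1t] := sup_adherent t0 (conj (S0 (c q)) (Sub (c q))).
apply: (cone_graph q1) => //; first by apply/aU/tdb; rewrite ge_min lexx orbT.
have dq : (q - t *: d) *m A = q *m A - t *: delta_mx 0 ord_max.
  by rewrite mulmxBl -scalemxAl dA.
have -> : h (q - t *: d) = h q - t by rewrite /h dq !mxE !eqxx mulr1.
have -> : c (q - t *: d) = c q.
  apply/rowP => k; rewrite /c dq !mxE eqxx /= eq_sym (negbTE (neq_lift _ _)).
  by rewrite mulr0 subr0.
by move: hq q1t; rewrite -/(h q) -/(c q) -/(g (c q)); lra.
Qed.

End RowVectors.

(** * The group operations in coordinates *)

Section HeisenbergCoordinates.
Variable R : realType.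
Implicit Types x y z l : R.

Definition hpt x y z : 'rV[R]_3 := \row_j [:: x; y; z]`_j.

Lemma hpt_eta (p : 'rV[R]_3) : p = hpt (p 0 0) (p 0 1) (p 0 2%:R).
Proof.
apply/rowP => -[[|[|[|//]]] i]; rewrite mxE /=;
  by congr (p 0 _); apply: val_inj.
Qed.

Lemma hpt_norm_le x y z (c : R) : `|hpt x y z| <= c ->
  [/\ `|x| <= c, `|y| <= c & `|z| <= c].
Proof.
move=> hc; have c0 : 0 <= c by apply: le_trans hc.
have /(rV_norm_le _ c0) h := hc.
by have := h 0; have := h 1; have := h 2%:R; rewrite !mxE /=.
Qed.

Lemma hptB x y z x' y' z' :
  hpt x y z - hpt x' y' z' = hpt (x - x') (y - y') (z - z').
Proof. by apply/rowP => -[[|[|[|//]]] i]; rewrite !mxE. Qed.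

Lemma hptZ l x y z : l *: hpt x y z = hpt (l * x) (l * y) (l * z).
Proof. by apply/rowP => -[[|[|[|//]]] i]; rewrite !mxE. Qed.

Lemma hpt0 : hpt 0 0 0 = 0.
Proof. by apply/rowP => -[[|[|[|//]]] i]; rewrite !mxE. Qed.

Lemma heis_mul_hpt x y z x' y' z' :
  heis_mul (hpt x y z) (hpt x' y' z') =
  hpt (x + x') (y + y') (z + z' + (x * y' - y * x') / 2).
Proof.
by apply/rowP => -[[|[|[|//]]] i]; rewrite !mxE /= ?mulr0 ?addr0 // mulr1 mulrC.
Qed.

Lemma heis_inv_hpt x y z : heis_inv (hpt x y z) = hpt (- x) (- y) (- z).
Proof. by apply/rowP => -[[|[|[|//]]] i]; rewrite !mxE. Qed.

Lemma heis_dil_hpt l x y z :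
  heis_dil l (hpt x y z) = hpt (l * x) (l * y) (l ^+ 2 * z).
Proof.
by apply/rowP => -[[|[|[|//]]] i];
  rewrite !mxE /= ?mulr0 ?mulr1 ?addr0 ?add0r.
Qed.

End HeisenbergCoordinates.

(** * Vertical shrinking and star-likeness *)

Section HomogeneousNorm.
Variables (R : realType) (N : 'rV[R]_3 -> R).
Hypothesis hN : homogeneous_norm N.
Implicit Types x y z l s t : R.

(** The coordinates of the product enter through equations, so each use of the triangle inequality
    leaves only algebraic identities. *)
Lemma hnorm_hpt_mul x y z x' y' z' x'' y'' z'' :
  x'' = x + x' -> y'' = y + y' -> z'' = z + z' + (x * y' - y * x') / 2 ->
  N (hpt x'' y'' z'') <= N (hpt x y z) + N (hpt x' y' z').
Proof. by move=> -> -> ->; rewrite -heis_mul_hpt hnorm_mul. Qed.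

Lemma hnorm_hptN x y z : N (hpt (- x) (- y) (- z)) = N (hpt x y z).
Proof. by rewrite -heis_inv_hpt hnorm_inv. Qed.

(** The factor 0, where both sides vanish, is included because the factor [b] in the next two proofs
    can be 0. *)
Lemma hnorm_hpt_dil l x y z : 0 <= l ->
  N (hpt (l * x) (l * y) (l ^+ 2 * z)) = l * N (hpt x y z).
Proof.
rewrite le_eqVlt => /predU1P[<-|l0]; last by rewrite -heis_dil_hpt hnorm_dil.
by rewrite expr0n /= !mul0r hpt0; apply/(hnorm_eq0 hN).
Qed.

(* For a + b = 1, the product of the dilates of (x, y, z) by a and b is
   (x, y, (a^2 + b^2) z). *)
Lemma hnorm_vertical_shrink k x y z : 2^-1 <= k <= 1 ->
  N (hpt x y (k * z)) <= N (hpt x y z).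
Proof.
(* With this [r], [a^2 + b^2 = (1 + r^2) / 2 = k]. *)
move=> /andP[k0 k1]; pose r := Num.sqrt (2 * k - 1).
have r2 : r ^+ 2 = 2 * k - 1 by rewrite sqr_sqrtr //; lra.
have r0 : 0 <= r by exact: sqrtr_ge0.
have r1 : r <= 1 by rewrite -(@ler_pXn2r _ 2) ?nnegrE // r2 expr1n; lra.
pose a := (1 + r) / 2; pose b := (1 - r) / 2.
have -> : N (hpt x y z) = a * N (hpt x y z) + b * N (hpt x y z).
  by rewrite -mulrDl /a /b; field.
have a0 : 0 <= a by rewrite /a; lra.
have b0 : 0 <= b by rewrite /b; lra.
rewrite -!hnorm_hpt_dil //.
apply: hnorm_hpt_mul; rewrite /a /b; [by field|by field|].
have -> : k = (r ^+ 2 + 1) / 2 by rewrite r2; field.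
by field.
Qed.

Lemma star_like_unit_ball : star_like (unit_ball N).
Proof.
move=> p; rewrite (hpt_eta p) /unit_ball /= => Np t /andP[t0 t1].
rewrite hptZ; set x := p 0 0 in Np *; set y := p 0 1 in Np *.
set z := p 0 2%:R in Np *.
(* Here [a + b = 1] and [a - b = a^2 - b^2 = t]; the bracket term vanishes because the horizontal
   parts are parallel. *)
pose a := (1 + t) / 2; pose b := (1 - t) / 2.
have a0 : 0 <= a by rewrite /a; lra.
have b0 : 0 <= b by rewrite /b; lra.
apply: (@le_trans _ _ ((a + b) * N (hpt x y z))); last first.
  by rewrite (_ : a + b = 1) ?mul1r // /a /b; field.
rewrite mulrDl -[in b * _]hnorm_hptN -!hnorm_hpt_dil //.
by apply: hnorm_hpt_mul; rewrite /a /b; field.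
Qed.

(** * Comparison with the topology of the vector space *)

Lemma hnorm_hptX x : N (hpt x 0 0) = `|x| * N (hpt 1 0 0).
Proof.
have [x0|x0] := ger0P x; last rewrite -hnorm_hptN oppr0;
  by rewrite -hnorm_hpt_dil ?mulr1 ?mulr0 //; lra.
Qed.

Lemma hnorm_hptY y : N (hpt 0 y 0) = `|y| * N (hpt 0 1 0).
Proof.
have [y0|y0] := ger0P y; last rewrite -hnorm_hptN oppr0;
  by rewrite -hnorm_hpt_dil ?mulr1 ?mulr0 //; lra.
Qed.

Lemma hnorm_hptZ z : N (hpt 0 0 z) = Num.sqrt `|z| * N (hpt 0 0 1).
Proof.
have [z0|z0] := ger0P z; last rewrite -hnorm_hptN oppr0;
  by rewrite -hnorm_hpt_dil ?sqrtr_ge0 // sqr_sqrtr ?mulr1 ?mulr0 //; lra.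
Qed.

(** In the symmetric product of [(x/2, 0, 0)], [(0, y, 0)] and [(x/2, 0, 0)] the two vertical
    contributions cancel. *)
Lemma hnorm_horizontal_le :
  exists2 C, 0 < C & forall x y, N (hpt x y 0) <= C * (`|x| + `|y|).
Proof.
have X0 := hnorm_ge0 hN (hpt 1 0 0); have Y0 := hnorm_ge0 hN (hpt 0 1 0).
exists (1 + N (hpt 1 0 0) + N (hpt 0 1 0)) => [|x y]; first lra.
have h1 : N (hpt x y 0) <=
    N (hpt (x / 2) y (x * y / 4)) + N (hpt (x / 2) 0 0).
  by apply: hnorm_hpt_mul; field.
have h2 : N (hpt (x / 2) y (x * y / 4)) <=
    N (hpt (x / 2) 0 0) + N (hpt 0 y 0).
  by apply: hnorm_hpt_mul; field.
move: h1 h2; rewrite hnorm_hptX hnorm_hptY.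
rewrite normrM (@ger0_norm _ 2^-1) ?invr_ge0 //.
by have := normr_ge0 x; have := normr_ge0 y; nra.
Qed.

Lemma hnorm_small (e : R) : 0 < e -> exists2 k, 0 < k &
  forall x y z, `|x| <= k -> `|y| <= k -> `|z| <= k -> N (hpt x y z) < e.
Proof.
move=> e0; have [C C0 hC] := hnorm_horizontal_le.
have Z0 := hnorm_ge0 hN (hpt 0 0 1).
pose Z := 1 + N (hpt 0 0 1); have Z1 : 0 < Z by rewrite /Z; lra.
(* The first bound makes the horizontal factor cost at most [e / 4]; the second, squared because the
   norm grows like a square root along the z-axis, makes the vertical factor cost at most
   [e / 2]. *)
pose k := Num.min (e / (8 * C)) ((e / (2 * Z)) ^+ 2).
have k1 : k <= e / (8 * C) by rewrite ge_min lexx.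
have k2 : k <= (e / (2 * Z)) ^+ 2 by rewrite ge_min lexx orbT.
exists k => [|x y z xk yk zk].
  by rewrite lt_min exprn_gt0 ?divr_gt0 ?mulr_gt0.
have h1 : N (hpt x y z) <= N (hpt x y 0) + N (hpt 0 0 z).
  by apply: hnorm_hpt_mul; field.
have h2 : C * (`|x| + `|y|) <= e / 4.
  rewrite -ler_pdivlMl // (_ : C^-1 * (e / 4) = 2 * (e / (8 * C))); first lra.
  by field; rewrite gt_eqF.
have h3 : Num.sqrt `|z| <= e / (2 * Z).
  rewrite -(@ler_pXn2r _ 2) ?nnegrE ?sqrtr_ge0 ?sqr_sqrtr //; first lra.
  by rewrite divr_ge0 ?mulr_ge0 ?ltW.
have h4 : Num.sqrt `|z| * N (hpt 0 0 1) <= e / 2.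
  rewrite (_ : e / 2 = e / (2 * Z) * Z); last by field; rewrite gt_eqF.
  by apply: ler_pM; rewrite ?sqrtr_ge0 // /Z; lra.
by move: h1 (hC x y); rewrite hnorm_hptZ; lra.
Qed.

(** For [p] in the ball close to [q], the product of [p^-1] and [q] has small coordinates, hence
    small norm, and [N q <= N p + e] follows. *)
Lemma closed_unit_ball : closed (unit_ball N).
Proof.
move=> q qB; rewrite /unit_ball /=; apply/ler_addgt0Pr => e e0.
have [k k0 hk] := hnorm_small e0.
rewrite (hpt_eta q); set x := q 0 0; set y := q 0 1; set z := q 0 2%:R.
(* The factor [m] absorbs the bracket of [p] and [q], which is linear in [q - p] with coefficients
   [x] and [y]. *)
pose m := 1 + `|x| + `|y|.
have x0 := normr_ge0 x; have y0 := normr_ge0 y.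
have m0 : 0 < m by rewrite /m; lra.
have [p [Bp]] := qB _ (nbhsx_ballx q (k / m) (divr_gt0 k0 m0)).
rewrite -ball_normE /= => /ltW.
rewrite {1}(hpt_eta q) (hpt_eta p) hptB -/x -/y -/z.
move: Bp; rewrite /unit_ball /= {1}(hpt_eta p).
set u := p 0 0; set v := p 0 1; set w := p 0 2%:R => Bp.
move=> /hpt_norm_le[xu yv zw].
have km : k / m <= k by rewrite ler_pdivrMr // /m; nra.
have mk : k / m * m = k by rewrite divfK ?gt_eqF.
have h1 : N (hpt x y z) <=
    N (hpt u v w) + N (hpt (x - u) (y - v) (z - w - (u * y - v * x) / 2)).
  by apply: hnorm_hpt_mul; field.
have h2 : N (hpt (x - u) (y - v) (z - w - (u * y - v * x) / 2)) < e.
  apply: hk; [lra|lra|].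
  have -> : z - w - (u * y - v * x) / 2 =
     (z - w) + ((x - u) * y - (y - v) * x) / 2 by field.
  have a1 : `|(x - u) * y| <= k / m * `|y| by rewrite normrM ler_wpM2r.
  have a2 : `|(y - v) * x| <= k / m * `|x| by rewrite normrM ler_wpM2r.
  have a3 : 0 <= k / m by rewrite ltW ?divr_gt0.
  move: zw a1 a2; rewrite !ler_norml => /andP[? ?] /andP[? ?] /andP[? ?].
  by rewrite -mk /m; apply/andP; split; nra.
lra.
Qed.

(** This keeps the origin, where both cone axes degenerate to 0, off the boundary. *)
Lemma interior_unit_ball0 : (unit_ball N)^° 0.
Proof.
have [k k0 hk] := hnorm_small (@ltr01 R).
apply/nbhs_ballP; exists k => //= q; rewrite -ball_normE /= sub0r normrN.
rewrite /unit_ball /= (hpt_eta q) => /ltW/hpt_norm_le[? ? ?].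
by rewrite ltW // hk.
Qed.

(** * Inner cones off and on the z-axis *)

(* Off the z-axis, w1 * r * w2 with w1 = a + b, w2 = a - b horizontal
   equals r + 2 a + [b, r + a]: the two free horizontal factors reach every
   small displacement at linear cost. *)
Lemma hnorm_lipschitz_off_axis : exists2 C, 0 < C &
  forall c x y z x' y' z', 0 < c -> c <= `|x + x'| \/ c <= `|y + y'| ->
  N (hpt x' y' z') <= N (hpt x y z) +
    C * (`|x' - x| + `|y' - y| + 4 / c * `|z' - z|).
Proof.
have [C C0 hC] := hnorm_horizontal_le; exists C => // c x y z x' y' z' c0 hc.
(* The equation for [b1] and [b2] makes the vertical coordinates match. One unknown will be set to 0
   and the other obtained by dividing by [x + x'] or [y + y'], whichever has size at least [c]. *)
have key b1 b2 : b1 * (y + y') - b2 * (x + x') = 2 * (z' - z) ->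
    `|b1| + `|b2| <= 2 / c * `|z' - z| ->
    N (hpt x' y' z') <= N (hpt x y z) +
      C * (`|x' - x| + `|y' - y| + 4 / c * `|z' - z|).
  move=> bE ble.
  pose a1 := (x' - x) / 2; pose a2 := (y' - y) / 2.
  pose m := z + ((a1 + b1) * y - (a2 + b2) * x) / 2.
  have h1 : N (hpt x' y' z') <=
     N (hpt (a1 + b1 + x) (a2 + b2 + y) m) + N (hpt (a1 - b1) (a2 - b2) 0).
    apply: hnorm_hpt_mul; rewrite /m /a1 /a2; [by field|by field|].
    have -> : z' = z + (b1 * (y + y') - b2 * (x + x')) / 2 by rewrite bE; field.
    by field.
  have h2 : N (hpt (a1 + b1 + x) (a2 + b2 + y) m) <=
     N (hpt (a1 + b1) (a2 + b2) 0) + N (hpt x y z).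
    by apply: hnorm_hpt_mul => //; rewrite /m; field.
  have h3 := hC (a1 + b1) (a2 + b2); have h4 := hC (a1 - b1) (a2 - b2).
  have h5 : `|a1 + b1| + `|a2 + b2| + (`|a1 - b1| + `|a2 - b2|) <=
      `|x' - x| + `|y' - y| + 4 / c * `|z' - z|.
    have -> : 4 / c * `|z' - z| = 2 * (2 / c * `|z' - z|).
      by field; rewrite gt_eqF.
    have n2 : `|2^-1| = 2^-1 :> R by rewrite ger0_norm ?invr_ge0.
    have := ler_normD a1 b1; have := ler_normD a2 b2.
    have := ler_normB a1 b1; have := ler_normB a2 b2.
    have := normrM (x' - x) 2^-1; have := normrM (y' - y) 2^-1.
    rewrite -/a1 -/a2 n2; lra.
  move: h5; rewrite -(ler_pM2l C0); lra.
have bound t : c <= `|t| -> `|2 * (z' - z) / t| <= 2 / c * `|z' - z|.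
  move=> ct; rewrite !normrM normfV (@ger0_norm _ 2) // mulrAC.
  by rewrite ler_wpM2r // ler_wpM2l // lef_pV2 ?posrE //; lra.
have neq0 t : c <= `|t| -> t != 0 by move=> ct; rewrite -normr_gt0; lra.
case: hc => hc.
  apply: (key 0 (- (2 * (z' - z) / (x + x')))).
    by field; exact: neq0.
  by rewrite normr0 add0r normrN; exact: bound.
apply: (key (2 * (z' - z) / (y + y')) 0).
  by field; exact: neq0.
by rewrite normr0 addr0; exact: bound.
Qed.

(** The point [q - s *: v] differs from the dilate of [q] by [1 - s] only by [s] times O([e]) in
    each coordinate. The Lipschitz bound turns this into at most [s * (e * A1) <= s], the room freed
    by the dilation. *)
Lemma inner_cone_off_axis c x0 y0 z0 : 0 < c -> c <= `|x0| \/ c <= `|y0| ->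
  exists2 e, 0 < e &
    uniform_inner_cone (unit_ball N) (hpt x0 y0 z0) (hpt x0 y0 (2 * z0)) e.
Proof.
move=> c0 hc; have [C C0 lip] := hnorm_lipschitz_off_axis.
have nx := normr_ge0 x0; have ny := normr_ge0 y0; have nz := normr_ge0 z0.
pose A1 := C * (4 + 4 / c * (4 + `|z0|)).
pose A2 := (4 + 2 * `|x0| + 2 * `|y0|) / c.
have A10 : 0 < A1.
  by rewrite mulr_gt0 // addr_gt0 // mulr_gt0 ?divr_gt0 //; lra.
have A20 : 0 < A2 by rewrite divr_gt0 //; lra.
pose e := (1 + A1 + A2)^-1.
have e0 : 0 < e by rewrite invr_gt0; lra.
have eE : e * (1 + A1 + A2) = 1 by rewrite mulVf // gt_eqF //; lra.
have e1 : e <= 1 by nra.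
have eA1 : e * A1 <= 1 by nra.
have eA2 : e * (4 + 2 * `|x0| + 2 * `|y0|) <= c.
  have -> : 4 + 2 * `|x0| + 2 * `|y0| = A2 * c by rewrite divfK // gt_eqF.
  rewrite mulrA ler_piMl ?ltW //; nra.
exists e => // q s v; rewrite (hpt_eta q) (hpt_eta v).
move: (q 0 0) (q 0 1) (q 0 2%:R) (v 0 0) (v 0 1) (v 0 2%:R).
move=> x y z v1 v2 v3 {q v}; rewrite /unit_ball /= !hptB hptZ hptB => Nq.
move=> /hpt_norm_le[xx yy zz] /andP[s0 se] /hpt_norm_le[vx vy vz].
have s1 : 0 <= 1 - s by lra.
have := lip c ((1 - s) * x) ((1 - s) * y) ((1 - s) ^+ 2 * z)
  (x - s * v1) (y - s * v2) (z - s * v3) c0.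
rewrite hnorm_hpt_dil //.
(* The sum of the two coordinates is within [e * (4 + 2 * |a0|) <= c] of [2 * a0], whose size is at
   least [2 * c]. *)
have near_sum a b a0 : c <= `|a0| -> `|a0| <= `|x0| + `|y0| ->
    `|a - a0| <= e -> `|b - a0| <= e ->
    c <= `|(1 - s) * a + (a - s * b)|.
  move=> ca a0xy aa ba.
  have ea : e * (4 + 2 * `|a0|) <= c.
    by apply: le_trans eA2; rewrite ler_pM2l //; lra.
  have -> : (1 - s) * a + (a - s * b) =
      2 * a0 - (s * (a + b) - 2 * (a - a0)) by ring.
  have := lerB_dist (2 * a0) (s * (a + b) - 2 * (a - a0)).
  have := ler_normB (s * (a + b)) (2 * (a - a0)).
  rewrite !normrM (ger0_norm s0) (@ger0_norm _ 2) //.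
  have ab : `|a + b| <= 2 * `|a0| + 2.
    have -> : a + b = 2 * a0 + ((a - a0) + (b - a0)) by ring.
    have := ler_normD (2 * a0) ((a - a0) + (b - a0)).
    have := ler_normD (a - a0) (b - a0).
    by rewrite normrM (@ger0_norm _ 2) //; lra.
  have : s * `|a + b| <= e * (2 * `|a0| + 2) by exact: ler_pM.
  lra.
have -> : x - s * v1 - (1 - s) * x = s * ((x - x0) - (v1 - x0)) by ring.
have -> : y - s * v2 - (1 - s) * y = s * ((y - y0) - (v2 - y0)) by ring.
have -> : z - s * v3 - (1 - s) ^+ 2 * z =
  s * (2 * (z - z0) - (v3 - 2 * z0) - s * (z - z0 + z0)) by ring.
rewrite !normrM (ger0_norm s0).
have dx := ler_normB (x - x0) (v1 - x0).
have dy := ler_normB (y - y0) (v2 - y0).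
have dz : `|2 * (z - z0) - (v3 - 2 * z0) - s * (z - z0 + z0)| <=
    e * (4 + `|z0|).
  have := ler_normB (2 * (z - z0) - (v3 - 2 * z0)) (s * (z - z0 + z0)).
  have := ler_normB (2 * (z - z0)) (v3 - 2 * z0).
  rewrite !normrM (ger0_norm s0) (@ger0_norm _ 2) //.
  have : s * `|z - z0 + z0| <= e * (1 + `|z0|).
    by apply: ler_pM => //; have := ler_normD (z - z0) z0; lra.
  lra.
have hd : c <= `|(1 - s) * x + (x - s * v1)| \/
    c <= `|(1 - s) * y + (y - s * v2)|.
  by case: hc => hc; [left; apply: (near_sum _ _ x0) => // |
    right; apply: (near_sum _ _ y0) => //]; lra.
move=> /(_ hd) /le_trans; apply.
set X := `|_ - (v1 - x0)| in dx *; set Y := `|_ - (v2 - y0)| in dy *.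
set Z := `|_ - s * _| in dz *.
have q0 : 0 < 4 / c by rewrite divr_gt0.
have hZ : 4 / c * Z <= 4 / c * (e * (4 + `|z0|)) by rewrite ler_pM2l.
have : s * (C * (X + Y + 4 / c * Z)) <= s * 1.
  apply: ler_wpM2l => //; apply: le_trans eA1; rewrite /A1 mulrCA ler_pM2l //.
  lra.
have : (1 - s) * N (hpt x y z) <= (1 - s) * 1 by rewrite ler_wpM2l.
lra.
Qed.

(** Dilating by [1 - s] lowers z at relative rate 2 only; the rate 3 leaves a surplus, taken by a
    vertical shrink with factor [k <= 1], which also absorbs the errors. *)
Lemma inner_cone_on_axis z0 : z0 != 0 ->
  exists2 e, 0 < e &
    uniform_inner_cone (unit_ball N) (hpt 0 0 z0) (hpt 0 0 (3 * z0)) e.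
Proof.
move=> z00; have [C C0 hC] := hnorm_horizontal_le.
have nz : 0 < `|z0| by rewrite normr_gt0.
pose e := (16 + 4 * C + 8 / `|z0|)^-1.
have q0 : 0 < 8 / `|z0| by rewrite divr_gt0.
have e0 : 0 < e by rewrite invr_gt0; lra.
have eE : e * (16 + 4 * C + 8 / `|z0|) = 1 by rewrite mulVf // gt_eqF //; lra.
have e16 : 16 * e <= 1 by nra.
have eC : 4 * C * e <= 1 by nra.
have ez : e * (8 / `|z0|) <= 1 by nra.
exists e => // q s v; rewrite (hpt_eta q) (hpt_eta v).
move: (q 0 0) (q 0 1) (q 0 2%:R) (v 0 0) (v 0 1) (v 0 2%:R).
move=> x y z v1 v2 v3 {q v}; rewrite /unit_ball /= !hptB hptZ hptB !subr0 => Nq.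
move=> /hpt_norm_le[xx yy zz] /andP[s0 se] /hpt_norm_le[vx vy vz].
pose l := 1 - s; have l0 : 0 < l by rewrite /l; lra.
(* [E] gathers the deviation of [v3] from the axis and the bracket with the horizontal correcting
   factor. *)
pose E := (v3 - 3 * z0) + l / 2 * (y * v1 - x * v2).
have El : `|E| <= 2 * e.
  apply: le_trans (ler_normD _ _) _.
  have e1 : e * e <= e * 1 by rewrite ler_pM2l //; lra.
  have a1 : `|y * v1| <= e * e by rewrite normrM ler_pM.
  have a2 : `|x * v2| <= e * e by rewrite normrM ler_pM.
  have a3 := ler_normB (y * v1) (x * v2).
  have : `|l / 2 * (y * v1 - x * v2)| <= 1 * `|y * v1 - x * v2| / 2.
    rewrite normrM mulrAC ler_wpM2r // ger0_norm; last by rewrite divr_ge0 ?ltW.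
    by rewrite ler_wpM2r // /l; lra.
  lra.
(* Dividing by [z0] makes the bounds on [k] independent of the sign of [z0]. *)
pose Z := z / z0; pose H := E / z0.
have Z1 : `|Z - 1| <= 8^-1.
  have -> : Z - 1 = (z - z0) / z0 by rewrite /Z; field.
  rewrite normrM normfV; apply: le_trans (ler_wpM2r _ zz) _.
    by rewrite invr_ge0 ltW.
  by move: ez; rewrite mulrCA; lra.
have H1 : `|H| <= 4^-1.
  rewrite normrM normfV; apply: le_trans (ler_wpM2r _ El) _.
    by rewrite invr_ge0 ltW.
  by move: ez; rewrite mulrCA; lra.
move: Z1 H1; rewrite !ler_norml => /andP[Z1 Z2] /andP[H1 H2].
have zE : z = Z * z0 by rewrite divfK.
have Z0 : 0 < Z by lra.
pose k := (Z - s * (3 + H)) / (l ^+ 2 * Z).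
have lZ : 0 < l ^+ 2 * Z by rewrite mulr_gt0 // exprn_gt0.
have k01 : 2^-1 <= k <= 1.
  rewrite /k ler_pdivlMr // ler_pdivrMr // /l.
  by apply/andP; split; nra.
(* k makes the z-coordinates agree once the horizontal factor has matched x
   and y. *)
have h1 : N (hpt (x - s * v1) (y - s * v2) (z - s * v3)) <=
    N (hpt (l * x) (l * y) (l ^+ 2 * (k * z))) +
    N (hpt (s * (x - v1)) (s * (y - v2)) 0).
  apply: hnorm_hpt_mul; rewrite /l; [by ring|by ring|].
  rewrite -/l (_ : l ^+ 2 * (k * z) = z - s * (3 * z0 + E)).
    by rewrite /E /l; field.
  rewrite /k /H zE; field.
  by rewrite z00 !gt_eqF.
move: h1; rewrite hnorm_hpt_dil ?(ltW l0) // => /le_trans; apply.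
have h2 := hC (s * (x - v1)) (s * (y - v2)).
have h3 : l * N (hpt x y (k * z)) <= l * 1.
  by rewrite ler_pM2l // (le_trans _ Nq) // hnorm_vertical_shrink.
have h4 : s * (C * (`|x - v1| + `|y - v2|)) <= s * 1.
  apply: ler_wpM2l => //; apply: le_trans eC.
  rewrite -mulrA mulrCA ler_pM2l //.
  by have := ler_normB x v1; have := ler_normB y v2; lra.
move: h2; rewrite !normrM (ger0_norm s0) /l in h3 *; lra.
Qed.

Lemma lipschitz_domain_unit_ball : lipschitz_domain (unit_ball N).
Proof.
apply: lipschitz_domain_cone; first exact: closed_unit_ball.
move=> p [_]; rewrite (hpt_eta p); move: (p 0 0) (p 0 1) (p 0 2%:R).
move=> x y z {p} pint.
have [x0|x0] := eqVneq x 0; last first.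
  have [||e e0 he] := @inner_cone_off_axis `|x| x y z.
  - by rewrite normr_gt0.
  - by left.
  exists (hpt x y (2 * z)), e; split => //.
  by apply: contra_neq x0 => /rowP/(_ 0); rewrite !mxE.
have [y0|y0] := eqVneq y 0; last first.
  have [||e e0 he] := @inner_cone_off_axis `|y| x y z.
  - by rewrite normr_gt0.
  - by right.
  exists (hpt x y (2 * z)), e; split => //.
  by apply: contra_neq y0 => /rowP/(_ 1); rewrite !mxE.
have [z0|z0] := eqVneq z 0.
  by case: pint; rewrite x0 y0 z0 hpt0; exact: interior_unit_ball0.
have [e e0 he] := inner_cone_on_axis z0.
exists (hpt 0 0 (3 * z)), e; rewrite x0 y0; split => //.
apply: contra_neq z0 => /rowP/(_ 2%:R); rewrite !mxE /= => /eqP.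
by rewrite mulf_eq0 pnatr_eq0 /= => /eqP.
Qed.

End HomogeneousNorm.

Theorem proposition6p1 (R : realType) (N : 'rV[R]_3 -> R)
    (hN : homogeneous_norm N) :
  star_like (unit_ball N) /\ lipschitz_domain (unit_ball N).
Proof.
by split; [exact: star_like_unit_ball | exact: lipschitz_domain_unit_ball].
Qed.
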